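(* Let $G$ be a countably compact $T_1$ paratopological group with a suitable set, let $H$ be a Hausdorff paratopological group, and let $f:G\to H$ be a continuous homomorphism with dense image. Then $H$ has a suitable set.
   Context: A paratopological group is a group $G$ endowed with a topology such that the group operation $G\times G\to G$ is continuous (inversion need not be continuous). The identity is denoted by $e$. A subset $S$ of a paratopological group $G$ is a suitable set for $G$ if $S$ is a discrete subspace of $G$, $S\cup\{e\}$ is closed in $G$, and the subgroup $\langle S\rangle$ of $G$ generated by $S$ is dense in $G$. A space $X$ is countably compact if each infinite subset $A$ of $X$ has an accumulation point $x\in X$ (each neighborhood of $x$ contains infinitely many points of $A$); for the $T_1$ spaces considered this is equivalent to each countable open cover of $X$ having a finite subcover. *)

(* Defs.v *)
From HB Require Import structures.
From mathcomp Require Import all_boot.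
From mathcomp Require Import all_classical topology.
Set Implicit Arguments.
Unset Strict Implicit.
Unset Printing Implicit Defensive.
Local Open Scope classical_set_scope.
Local Open Scope group_scope.

HB.mixin Record isParatopologicalGroup G of Group G & Topological G := {
  mulg_continuous : continuous (fun x : G * G => x.1 * x.2)
}.

#[short(type="paratopologicalGroupType")]
HB.structure Definition ParatopologicalGroup :=
  {G of Group G & Topological G & isParatopologicalGroup G}.

(* [smallest C S] is the intersection of all [K] satisfying [C] and
   containing [S]. *)
Definition generated_subgroup (G : groupType) (S : set G) : set G :=
  smallest (fun K : set G => group_closed [in K]) S.

(* [set_type S] carries the topology induced by the inclusion into [T]. *)
Definition discrete_subspace (T : topologicalType) (S : set T) : Prop :=
  forall U : set (set_type S), open U.

Definition suitable_set (G : paratopologicalGroupType) (S : set G) : Prop :=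
  [/\ discrete_subspace S,
      closed (S `|` [set 1]) &
      dense (generated_subgroup S)].

(* Stronger than the library's [limit_point] outside T1 spaces: every
   neighbourhood must contain infinitely many points of [A]. *)
Definition accumulation_point (T : topologicalType) (A : set T) (x : T) :
    Prop :=
  forall U : set T, nbhs x U -> infinite_set (U `&` A).

Definition countably_compact (T : topologicalType) : Prop :=
  forall A : set T, infinite_set A -> exists x : T, accumulation_point A x.

(* Main.v *)
(** In a countably compact space an infinite subset of [S] accumulates
    somewhere in the closed set [S `|` [set 1]], hence at [1] as [S] is
    discrete; so every neighbourhood of [1] contains all but finitely many
    points of [S].  This property passes to the image [f @` S], and in a
    Hausdorff space it makes [f @` S `\ 1] discrete and closed up to adding
    [1]. *)
Require Import Defs.
From mathcomp Require Import all_boot.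
From mathcomp Require Import all_classical topology.
Local Open Scope classical_set_scope.

Lemma discrete_subspace_isolated (T : topologicalType) (S : set T) (x : T) :
  discrete_subspace S -> S x -> exists2 V, nbhs x V & V `&` S `<=` [set x].
Proof.
(* The singleton of [x] is open in the subspace, hence the trace of an open [V] of [T]. *)
move=> dS Sx; have [V oV VE] := dS [set SigSub (mem_set Sx)].
have mem_V y (Sy : S y) :
    V y = (SigSub (mem_set Sy) = SigSub (mem_set Sx) :> set_type S).
  by have := congr1 (@^~ (SigSub (mem_set Sy))) VE.
exists V; first by apply: open_nbhs_nbhs; split=> //; rewrite (mem_V _ Sx).
by move=> y [Vy Sy]; move: Vy; rewrite (mem_V _ Sy) => /(congr1 val).
Qed.

Lemma isolated_discrete_subspace (T : topologicalType) (S : set T) :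
  (forall x, S x -> exists2 V, nbhs x V & V `&` S `<=` [set x]) ->
  discrete_subspace S.
Proof.
move=> isoS U; rewrite openE => x Ux.
have Sx : S (val x) := set_mem (valP x).
have [V nV VS] := isoS _ Sx.
have val_nbhs : nbhs x (val @^-1` V) by apply: initial_continuous.
apply: filterS val_nbhs => y Vy.
have /val_inj -> // : val y = val x.
by apply: VS; split=> //; exact: set_mem (valP y).
Qed.

Lemma countably_compact_finite_setD (T : topologicalType) (S : set T) (p : T)
    (U : set T) :
  countably_compact T -> discrete_subspace S -> closed (S `|` [set p]) ->
  nbhs p U -> finite_set (S `\` U).
Proof.
move=> ccT dS clS nU; apply: contrapT => /ccT[x accx].
have : (S `|` [set p]) x.
  apply: clS => V /accx/infinite_setN0[y [Vy [Sy _]]].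
  by exists y; split=> //; left.
case=> [Sx|xp].
  have [V nV VS] := discrete_subspace_isolated _ _ _ dS Sx.
  apply: (accx _ nV); apply: sub_finite_set (finite_set1 x).
  by move=> y [Vy [Sy _]]; apply: VS.
(* At [p] the contradiction comes from [U] itself, a neighbourhood disjoint from [S]\[U]. *)
rewrite {}xp in accx.
by have /infinite_setN0[y [Uy [_ /(_ Uy)]]] := accx _ nU.
Qed.

Section AlmostConvergent.
Context {T : topologicalType} (S : set T) (p : T).
Hypothesis T_hausdorff : hausdorff_space T.
Hypothesis S_finite : forall U, nbhs p U -> finite_set (S `\` U).

(** Separate [x] from [p] by open sets [A] and [B]. Only finitely many points of [S] lie outside
    [B], and finite sets are closed, so deleting those other than [x] from [A] leaves a
    neighbourhood of [x]. Since [x] may lie outside [S], this serves both discreteness and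
    closedness. *)
Let S_isolated (x : T) :
  x <> p -> exists2 V, nbhs x V & V `&` (S `|` [set p]) `<=` [set x].
Proof.
move=> /eqP xp; move: (T_hausdorff); rewrite open_hausdorff => /(_ _ _ xp).
case=> -[/= A B] [/set_mem Ax /set_mem Bp] [oA oB /eqP AB0].
have F_closed : closed ((S `\` B) `\ x).
  apply: (accessible_finite_set_closed.1 (hausdorff_accessible T_hausdorff)).
  exact/finite_setD/S_finite/open_nbhs_nbhs.
exists (A `&` ~` ((S `\` B) `\ x)).
  apply: open_nbhs_nbhs; split; first by apply: openI; rewrite ?openC.
  by split=> // -[_ /(_ erefl)].
have AB y : A y -> ~ B y by move=> Ay By; rewrite -[False]/(set0 y) -AB0.
move=> y [[Ay nF] [Sy|yp]]; last by case: (AB y Ay); rewrite yp.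
by apply: contrapT => yx; apply: nF; split=> //; split=> //; exact: AB.
Qed.

Lemma almost_convergent_discrete : discrete_subspace (S `\ p).
Proof.
apply: isolated_discrete_subspace => x [_ xp].
have [V nV VS] := S_isolated _ xp.
by exists V => // y [Vy [Sy _]]; apply: VS; split=> //; left.
Qed.

Lemma almost_convergent_closed : closed ((S `\ p) `|` [set p]).
Proof.
move=> x clx; have [->|xp] := pselect (x = p); first by right.
have [V nV VS] := S_isolated _ xp.
(* The only point of the set that [V] can meet is [x], so [x] belongs to the set. *)
have [y [Sy Vy]] := clx _ nV.
suff <- : y = x by [].
by apply: VS; split=> //; case: Sy => [[Sy _]|]; [left|right].
Qed.

End AlmostConvergent.

Lemma dense_image (T U : topologicalType) (f : T -> U) (A : set T) :
  continuous f -> dense (range f) -> dense A -> dense (f @` A).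
Proof.
move=> f_cont f_dense A_dense O O0 oO.
have [_ [/[swap] -[x _ <-] Ofx]] := f_dense _ O0 oO.
have [||y [Ofy Ay]] := A_dense (f @^-1` O); first by exists x.
  by apply: open_comp => // z _; exact: f_cont.
by exists (f y); split=> //; exists y.
Qed.

Lemma denseS (T : topologicalType) (A B : set T) :
  A `<=` B -> dense A -> dense B.
Proof.
by move=> AB A_dense O O0 oO; have [x [Ox /AB Bx]] := A_dense O O0 oO; exists x.
Qed.

(** Write [x] as [(x / y) * y], apply [f] and cancel [f y]. *)
Lemma multiplicative_gmulfF (G H : groupType) (f : {multiplicative G -> H}) :
  {morph f : x y / (x / y)%g}.
Proof.
by move=> x y; rewrite -[in RHS](mulgVK y x) (gmulfM (x / y)%g) mulgK.
Qed.

(** If a subgroup [K] contains [f @] S [\ 1], its preimage is a subgroup containing [S]: points of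
    [S] sent to [1] land in [K] anyway. *)
Lemma generated_subgroup_image (G H : groupType) (f : {multiplicative G -> H})
    (S : set G) :
  f @` generated_subgroup S `<=` generated_subgroup (f @` S `\ 1%g).
Proof.
move=> _ [x Sx <-] K [[K1 KF] SK].
apply: (Sx (f @^-1` K)); split; last first.
  move=> y Sy /=; have [->|fy1] := pselect (f y = 1%g); first exact: set_mem.
  by apply: SK; split=> //; exists y.
split=> [|y z].
  apply/mem_set.
  by rewrite /= -(mulgV 1%g) multiplicative_gmulfF mulgV; exact: set_mem.
move=> /set_mem Ky /set_mem Kz; apply/mem_set => /=.
by rewrite multiplicative_gmulfF; apply/set_mem/KF; exact: mem_set.
Qed.

Theorem proposition3p6 (G H : paratopologicalGroupType)
    (G_cc : countably_compact G) (G_T1 : accessible_space G)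
    (G_suitable : exists S : set G, suitable_set S)
    (H_hausdorff : hausdorff_space H)
    (f : {multiplicative G -> H}) (f_continuous : continuous f)
    (f_dense : dense (range f)) :
  exists S : set H, suitable_set S.
Proof.
case: G_suitable => S [dS clS S_dense].
have f1 : f 1%g = 1%g by rewrite -(mulgV 1%g) multiplicative_gmulfF mulgV.
have fS_finite (U : set H) : nbhs 1%g U -> finite_set (f @` S `\` U).
  rewrite -f1 => /f_continuous nU.
  have := countably_compact_finite_setD _ _ _ _ G_cc dS clS nU.
  move=> /(finite_image f); apply: sub_finite_set.
  by move=> _ [[x Sx <-] nUfx]; exists x.
(* The identity is removed because [f] may send a point of [S] to [1] while the other images
   accumulate there. *)
exists (f @` S `\ 1%g); split.
- exact: almost_convergent_discrete.
- exact: almost_convergent_closed.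
- exact/(denseS _ _ _ (generated_subgroup_image _ _ f S))/dense_image.
Qed.
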